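(* Let $(\mathcal{M},g)$ be an $n$-dimensional spacetime, $n\ge 3$, admitting a semi-symmetric metric connection $\nabla$ whose associated vector field is $v$ and whose curvature tensor $\overline{R}$ vanishes identically. If $v$ is a unit time-like torse-forming vector field, i.e. $g_{hk}v^hv^k=-1$ and $\nabla_k v_h=\phi\,(v_kv_h+g_{kh})$ for some scalar function $\phi$ on $\mathcal{M}$, then $\mathcal{M}$ is a perfect fluid spacetime.
   Context: A spacetime is a connected time-oriented Lorentzian manifold $(\mathcal{M},g)$. $\mathrm{D}$ denotes the Levi-Civita connection of $g$, and $R_{hk}$ the Ricci tensor of $\mathrm{D}$. A semi-symmetric metric connection on $\mathcal{M}$ with associated vector field $v$ is a linear connection $\nabla$ with $\nabla g=0$ whose torsion $T(U,V)=\nabla_UV-\nabla_VU-[U,V]$ satisfies $T(U,V)=\pi(V)U-\pi(U)V$, where $\pi(U)=g(U,v)$; equivalently $\nabla_UV=\mathrm{D}_UV+\pi(V)U-g(U,V)v$. Write $v_h=g_{hk}v^k$. $\overline{R}$ is the curvature tensor of the connection $\nabla$. Torse-forming: a vector field $u$ is torse-forming if $\nabla_k u_h=\omega_k u_h+\phi g_{kh}$ for a non-vanishing 1-form $\omega_k$ and a scalar function $\phi$; for a unit time-like vector field this condition is taken in the form $\nabla_k u_h=\phi(u_ku_h+g_{kh})$. Here $\nabla$ is the semi-symmetric metric connection. Perfect fluid spacetime: a spacetime is called a perfect fluid spacetime if its non-vanishing Ricci tensor satisfies $R_{hk}=\alpha g_{hk}+\beta w_hw_k$ for some smooth functions $\alpha,\beta$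 on $\mathcal{M}$ and a vector field $w$ (the velocity vector) with $g_{hk}w^hw^k=-1$, $w_h=g_{hk}w^k$. *)

(* Defs.v *)
From HB Require Import structures.
From mathcomp Require Import all_boot all_order all_algebra.
From mathcomp Require Import all_classical all_reals all_analysis.

Set Implicit Arguments.
Unset Strict Implicit.
Unset Printing Implicit Defensive.

Import Order.TTheory GRing.Theory Num.Theory.
Import numFieldNormedType.Exports.

Local Open Scope classical_set_scope.
Local Open Scope ring_scope.

(* Points and vectors of R^n are row vectors. Fields on a manifold are families
   of component functions, one for each chart, defined on the coordinate space
   'rV[R]_n; only their values on the image of the chart matter. *)

Section Coordinates.
Variables (R : realType) (n : nat).
Local Notation V := 'rV[R]_n.

Definition ebase (i : 'I_n) : V := delta_mx 0 i.

Fixpoint Ck_on (k : nat) (U : set V) (f : V -> R) : Prop :=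
  (forall x, U x -> {for x, continuous f}) /\
  (if k is k'.+1 then
     forall i : 'I_n, (forall x, U x -> derivable f x (ebase i)) /\
                      Ck_on k' U (fun x => 'D_(ebase i) f x)
   else True).

Definition smooth_on (U : set V) (f : V -> R) := forall k, Ck_on k U f.

Definition smooth_field_on (U : set V) (X : V -> V) :=
  forall i, smooth_on U (fun x => X x 0 i).

Definition inner (G : 'M[R]_n) (u w : V) : R := \sum_i \sum_j G i j * u 0 i * w 0 j.

Definition lower (G : 'M[R]_n) (u : V) : V := \row_h \sum_k G h k * u 0 k.

(* diag(-1, 1, ..., 1) *)
Definition minkowski : 'M[R]_n :=
  diag_mx (\row_i (if (i : nat) == 0%N then - 1 else 1)).

Definition lorentzian (G : 'M[R]_n) :=
  G^T = G /\ exists2 E : 'M[R]_n, E \in unitmx & E *m G *m E^T = minkowski.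

(* Connection symbols: Gam x i j is the vector nabla_(e_i) e_j at x, so that
   Gam x i j 0 k is Gamma^k_(i j), the first lower index being the direction
   of differentiation (Gamma need not be symmetric). *)
Definition symbols := V -> 'I_n -> 'I_n -> V.

Implicit Types (Gam : symbols) (X Y Z : V -> V).

Definition gamma (S : 'I_n -> 'I_n -> V) (u w : V) : V :=
  \sum_i \sum_j (u 0 i * w 0 j) *: S i j.

Definition cov Gam X Y : V -> V :=
  fun x => 'D_(X x) Y x + gamma (Gam x) (X x) (Y x).

Definition lie_bracket X Y : V -> V := fun x => 'D_(X x) Y x - 'D_(Y x) X x.

Definition torsion Gam X Y : V -> V :=
  fun x => cov Gam X Y x - cov Gam Y X x - lie_bracket X Y x.

Definition curvature Gam X Y Z : V -> V :=
  fun x => cov Gam X (cov Gam Y Z) x - cov Gam Y (cov Gam X Z) x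
           - cov Gam (lie_bracket X Y) Z x.

(* R_(h k) is the trace of X |-> R(X, e_h) e_k *)
Definition ricci Gam (x : V) (h k : 'I_n) : R :=
  \sum_i curvature Gam (fun=> ebase i) (fun=> ebase h) (fun=> ebase k) x 0 i.

(* nabla_k u_h for a covector field u *)
Definition cov_form Gam (u : V -> V) (x : V) (k h : 'I_n) : R :=
  'D_(ebase k) (fun y => u y 0 h) x - \sum_j Gam x k h 0 j * u x 0 j.

(* nabla_k g_(i j) *)
Definition cov_metric Gam (g : V -> 'M[R]_n) (x : V) (k i j : 'I_n) : R :=
  'D_(ebase k) (fun y => g y i j) x
  - \sum_l Gam x k i 0 l * g x l j - \sum_l Gam x k j 0 l * g x i l.

Definition christoffel (g : V -> 'M[R]_n) : symbols := fun x i j =>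
  \row_k (2^-1 * \sum_l invmx (g x) k l *
    ('D_(ebase i) (fun y => g y j l) x + 'D_(ebase j) (fun y => g y i l) x
     - 'D_(ebase l) (fun y => g y i j) x)).

End Coordinates.

Record manifold (R : realType) (n : nat) := Manifold {
  carrier :> topologicalType;
  chart : Type;
  dom : chart -> set carrier;
  chart_map : chart -> carrier -> 'rV[R]_n;
  chart_inv : chart -> 'rV[R]_n -> carrier;
  manifold_hausdorff : hausdorff_space carrier;
  manifold_second_countable : @second_countable carrier;
  chart_cover : forall p, exists c, dom c p;
  dom_is_open : forall c, open (dom c);
  image_is_open : forall c, open (chart_map c @` dom c);
  chart_mapK : forall c p, dom c p -> chart_inv c (chart_map c p) = p;
  chart_map_continuous : forall c p, dom c p -> {for p, continuous (chart_map c)};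
  chart_inv_continuous : forall c x, (chart_map c @` dom c) x -> {for x, continuous (chart_inv c)};
  transition_smooth : forall c d,
    smooth_field_on (chart_map c @` (dom c `&` dom d)) (chart_map d \o chart_inv c)
}.

Section Fields.
Variables (R : realType) (n : nat) (M : manifold R n).

Definition chart_image (c : chart M) : set 'rV[R]_n := chart_map c @` dom c.

Definition transition (c d : chart M) : 'rV[R]_n -> 'rV[R]_n := chart_map d \o chart_inv c.

Definition smooth_function (f : M -> R) :=
  forall c : chart M, smooth_on (chart_image c) (f \o chart_inv c).

Record vector_field := VectorField {
  vf :> chart M -> 'rV[R]_n -> 'rV[R]_n;
  vf_smooth : forall c, smooth_field_on (chart_image c) (vf c);
  vf_transform : forall c d p, dom c p -> dom d p ->
    vf d (chart_map d p) = 'D_(vf c (chart_map c p)) (transition c d) (chart_map c p)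
}.

Record lorentz_metric := LorentzMetric {
  met :> chart M -> 'rV[R]_n -> 'M[R]_n;
  met_smooth : forall c i j, smooth_on (chart_image c) (fun x => met c x i j);
  met_lorentzian : forall c x, chart_image c x -> lorentzian (met c x);
  met_transform : forall c d p u w, dom c p -> dom d p ->
    inner (met c (chart_map c p)) u w =
    inner (met d (chart_map d p)) ('D_u (transition c d) (chart_map c p))
                              ('D_w (transition c d) (chart_map c p))
}.

(* With tau the transition map,
   dtau(Gamma(e_i, e_j)) = d_i d_j tau + Gamma'(d_i tau, d_j tau). *)
Record linear_connection := LinearConnection {
  conn :> chart M -> symbols R n;
  conn_smooth : forall c i j k, smooth_on (chart_image c) (fun x => conn c x i j 0 k);
  conn_transform : forall c d p i j, dom c p -> dom d p ->
    let x := chart_map c p in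
    'D_(conn c x i j) (transition c d) x =
    'D_(ebase R i) (fun y => 'D_(ebase R j) (transition c d) y) x
    + gamma (conn d (chart_map d p)) ('D_(ebase R i) (transition c d) x)
                                 ('D_(ebase R j) (transition c d) x)
}.

Definition semi_symmetric_metric_connection
    (g : lorentz_metric) (nabla : linear_connection) (v : vector_field) :=
  (forall c x, chart_image c x ->
     forall k i j, cov_metric (nabla c) (g c) x k i j = 0) /\
  (forall c X Y, smooth_field_on (chart_image c) X -> smooth_field_on (chart_image c) Y ->
     forall x, chart_image c x ->
       let pi U := inner (g c x) U (v c x) in
       torsion (nabla c) X Y x = pi (Y x) *: X x - pi (X x) *: Y x).

Definition flat (nabla : linear_connection) :=
  forall c X Y Z, smooth_field_on (chart_image c) X -> smooth_field_on (chart_image c) Y ->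
    smooth_field_on (chart_image c) Z ->
    forall x, chart_image c x -> curvature (nabla c) X Y Z x = 0.

Definition unit_timelike (g : lorentz_metric) (v : vector_field) :=
  forall c x, chart_image c x -> inner (g c x) (v c x) (v c x) = - 1.

(* nabla_k v_h = phi (v_k v_h + g_(k h)) *)
Definition unit_torse_forming
    (g : lorentz_metric) (nabla : linear_connection) (v : vector_field) :=
  exists phi : M -> R, forall c x, chart_image c x ->
    let v_ y := lower (g c y) (v c y) in
    forall k h, cov_form (nabla c) v_ x k h =
      phi (chart_inv c x) * (v_ x 0 k * v_ x 0 h + g c x k h).

End Fields.

Record spacetime (R : realType) (n : nat) := Spacetime {
  space :> manifold R n;
  space_nonempty : [set: space] !=set0;
  space_connected : connected [set: space];
  spacetime_metric : lorentz_metric space;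
  (* the time orientation is the one for which time_dir is future-directed *)
  time_dir : vector_field space;
  time_dir_timelike : forall c x, chart_image c x ->
    inner (spacetime_metric c x) (time_dir c x) (time_dir c x) < 0
}.

Definition ricci_tensor (R : realType) (n : nat) (S : spacetime R n) (c : chart S) :=
  ricci (christoffel (spacetime_metric S c)).

Definition perfect_fluid (R : realType) (n : nat) (S : spacetime R n) :=
  (forall c x, @chart_image R n S c x -> exists h k, ricci_tensor c x h k != 0) /\
  exists (alpha beta : S -> R) (w : vector_field S),
    [/\ smooth_function alpha, smooth_function beta,
        unit_timelike (spacetime_metric S) w &
        forall c x, @chart_image R n S c x ->
          let w_ := lower (spacetime_metric S c x) (w c x) in
          forall h k, ricci_tensor c x h k =
            alpha (chart_inv c x) * spacetime_metric S c x h k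
            + beta (chart_inv c x) * w_ 0 h * w_ 0 k].

(* Main.v *)
Require Import Defs.
From mathcomp Require Import all_boot all_order all_algebra.
From mathcomp Require Import all_classical all_reals all_analysis.
From mathcomp Require Import ring.

(** Write D for the Levi-Civita connection and pi for the 1-form dual to v. Both
    nabla and D are metric, so the torsion of nabla determines their difference:
    D_U W = nabla_U W - pi(W) U + g(U, W) v ([koszul]).

    Since nabla g = 0, the torse-forming equation for the covector v_h can be
    raised to nabla_k v = phi (v_k v + e_k) ([torse_forming_vector]). So the
    derivatives of g, of v and of pi along a basis field are all explicit in
    terms of the symbols of nabla. Substituting them in the curvature of D, the
    symbols of nabla only survive through the curvature of nabla, which is zero,
    and through its torsion, which is known. What remains
    ([levi_civita_curvature]) is

      R(X, Y) Z = (1 + 2 phi) (g(Y, Z) X - g(X, Z) Y)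
                  + phi (pi(Y) pi(Z) X - pi(X) pi(Z) Y)
                  + phi (g(Y, Z) pi(X) - g(X, Z) pi(Y)) v,

    whose trace over X, using pi(v) = -1, is

      R_hk = (n - 1 + (2n - 3) phi) g_hk + (n - 2) phi v_h v_k.

    This is the perfect fluid form with velocity v. Two points remain.
    - Smoothness: torse-forming only provides some function phi; it is smooth
      because tracing nabla_k v^l = phi (v_k v^l + delta_k^l) gives
      (n - 1) phi as the divergence of v for nabla ([div_v]).
    - The Ricci tensor vanishes at no point: as n >= 2, g and v_h v_k are
      linearly independent ([fluid_eq0]), so both coefficients would vanish,
      that is phi = 0 (because n > 2) and then n - 1 = 0.

    All of this is local and tensorial, hence is checked in one chart at a time
    on the coordinate basis fields, where no second derivative of g or of v has
    to be handled. *)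

Set Implicit Arguments.
Unset Strict Implicit.
Unset Printing Implicit Defensive.

Import Order.TTheory GRing.Theory Num.Theory.
Import numFieldNormedType.Exports.

Local Open Scope classical_set_scope.
Local Open Scope ring_scope.

(** * Smooth functions on an open set *)

Lemma near_eq_continuous (T T' : topologicalType) (f g : T -> T') (x : T) :
  (\near x, f x = g x) -> {for x, continuous f} -> {for x, continuous g}.
Proof.
move=> fg cf; rewrite /prop_for /continuous_at -(nbhs_singleton fg).
exact: cvg_trans (near_eq_cvg fg) cf.
Qed.

Section Smoothness.
Variables (R : realType) (n : nat).
Local Notation V := 'rV[R]_n.
Implicit Types (U : set V) (f g : V -> R).

Lemma Ck_onW k U f : Ck_on k.+1 U f -> Ck_on k U f.
Proof.
elim: k f => [|k IH] f [cf df]; first by split.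
by split=> // i; have [? ?] := df i; split=> //; exact: IH.
Qed.

Lemma near_open U x (P : V -> Prop) : open U -> U x ->
  (forall y, U y -> P y) -> \near x, P x.
Proof. by move=> oU Ux UP; apply: filterS UP _; exact: open_nbhs_nbhs. Qed.

(** Openness of [U] is what makes this true: the derivatives at a point of [U]
    only see the values on [U]. *)
Lemma Ck_on_eq k U f g : open U -> (forall x, U x -> f x = g x) ->
  Ck_on k U f -> Ck_on k U g.
Proof.
move=> oU; elim: k f g => [|k IH] f g fg [cf df]; split=> //.
- by move=> x Ux; apply: near_eq_continuous (cf x Ux); exact: near_open fg.
- by move=> x Ux; apply: near_eq_continuous (cf x Ux); exact: near_open fg.
- move=> i; have [dfi Ckf] := df i; split=> [x Ux|].
    by apply: near_eq_derivable (dfi x Ux); exact: near_open fg.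
  by apply: IH Ckf => x Ux; apply: near_eq_derive; exact: near_open fg.
Qed.

Lemma Ck_on_cst k U (a : R) : Ck_on k U (fun=> a).
Proof.
elim: k a => [|k IH] a; split=> //; try by move=> x _; exact: cst_continuous.
move=> i; split=> [x _|]; first exact: derivable_cst.
suff -> : (fun x : V => 'D_(ebase R i) (fun=> a) x) = fun=> 0 by exact: IH.
by apply/funext => x; exact: derive_cst.
Qed.

Lemma Ck_onD k U f g : open U -> Ck_on k U f -> Ck_on k U g ->
  Ck_on k U (fun x => f x + g x).
Proof.
move=> oU; elim: k f g => [|k IH] f g [cf df] [cg dg]; split=> //.
- by move=> x Ux; exact: continuousD (cf x Ux) (cg x Ux).
- by move=> x Ux; exact: continuousD (cf x Ux) (cg x Ux).
move=> i; have [dfi Ckf] := df i; have [dgi Ckg] := dg i; split=> [x Ux|].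
  by apply: derivableD; [exact: dfi|exact: dgi].
apply: Ck_on_eq (IH _ _ Ckf Ckg) => // x Ux.
by rewrite -deriveD//; [exact: dfi|exact: dgi].
Qed.

Lemma Ck_onM k U f g : open U -> Ck_on k U f -> Ck_on k U g ->
  Ck_on k U (fun x => f x * g x).
Proof.
move=> oU; elim: k f g => [|k IH] f g Ckf Ckg.
  by split=> // x Ux; exact: continuousM (Ckf.1 x Ux) (Ckg.1 x Ux).
have [[cf df] [cg dg]] := (Ckf, Ckg); split=> [x Ux|i].
  by exact: continuousM (cf x Ux) (cg x Ux).
have [dfi Ckdf] := df i; have [dgi Ckdg] := dg i; split=> [x Ux|].
  by apply: derivableM; [exact: dfi|exact: dgi].
apply: (@Ck_on_eq _ _ (fun x => f x * 'D_(ebase R i) g x + g x * 'D_(ebase R i) f x)) => //.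
  by move=> x Ux; exact/esym/(deriveM (dfi x Ux) (dgi x Ux)).
by apply: Ck_onD => //; apply: IH => //; exact: Ck_onW.
Qed.

Lemma smooth_on_sum U (I : Type) (r : seq I) (f : I -> V -> R) : open U ->
  (forall i, smooth_on U (f i)) -> smooth_on U (fun x => \sum_(i <- r) f i x).
Proof.
move=> oU sf k; elim: r => [|i r IH].
  by apply: Ck_on_eq (@Ck_on_cst k U 0) => // x _; rewrite big_nil.
apply: Ck_on_eq (Ck_onD oU (sf i k) IH) => // x _.
by rewrite big_cons.
Qed.

Lemma smooth_on_derivable U f i x : smooth_on U f -> U x ->
  derivable f x (ebase R i).
Proof. by move=> sf Ux; have [_ /(_ i)[+ _]] := sf 1%N; exact. Qed.

Lemma smooth_on_derive U f i : smooth_on U f ->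
  smooth_on U (fun x => 'D_(ebase R i) f x).
Proof. by move=> sf k; have [_ /(_ i)[]] := sf k.+1. Qed.

Lemma smooth_field_cst U (w : V) : smooth_field_on U (fun=> w).
Proof. by move=> i k; exact: Ck_on_cst. Qed.

Lemma is_derive_bigsum (W : normedModType R) (I : Type) (r : seq I)
    (h : I -> V -> W) (dh : I -> W) x w :
  (forall i, is_derive x w (h i) (dh i)) ->
  is_derive x w (fun y => \sum_(i <- r) h i y) (\sum_(i <- r) dh i).
Proof.
move=> dhi; elim: r => [|i r IH].
  rewrite big_nil (_ : (fun _ => _) = cst 0) ?funeqE; first exact: is_derive_cst.
  by move=> y; rewrite big_nil.
rewrite big_cons (_ : (fun _ => _) = h i + (fun y => \sum_(i <- r) h i y)).
  exact: is_deriveD.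
by rewrite funeqE => y; rewrite big_cons.
Qed.

End Smoothness.

(** * Pointwise algebra of a metric and connection symbols *)

Section PointwiseAlgebra.
Variables (R : realType) (n : nat).
Local Notation V := 'rV[R]_n.
Local Notation e := (ebase R (n:=n)).
Implicit Types (G : 'M[R]_n) (u w z : V) (S : 'I_n -> 'I_n -> V).

Lemma ebaseE i j : e i 0 j = (i == j)%:R.
Proof. by rewrite mxE eqxx eq_sym. Qed.

Lemma sum_ebase i (f : 'I_n -> R) : \sum_j f j * e i 0 j = f i.
Proof.
rewrite (bigD1 i)//= ebaseE eqxx mulr1 big1 ?addr0// => j /negPf ji.
by rewrite ebaseE eq_sym ji mulr0.
Qed.

Lemma innerDl G u w z : inner G (u + w) z = inner G u z + inner G w z.
Proof.
rewrite -big_split; apply: eq_bigr => i _; rewrite -big_split/=.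
by apply: eq_bigr => j _; rewrite mxE; ring.
Qed.

Lemma innerZl G (a : R) u z : inner G (a *: u) z = a * inner G u z.
Proof.
rewrite mulr_sumr; apply: eq_bigr => i _; rewrite mulr_sumr/=.
by apply: eq_bigr => j _; rewrite mxE; ring.
Qed.

Lemma innerC G u w : G^T = G -> inner G u w = inner G w u.
Proof.
move=> GT; rewrite /inner exchange_big; apply: eq_bigr => i _ /=.
by apply: eq_bigr => j _; rewrite -{1}GT mxE; ring.
Qed.

Lemma innerDr G u w z : inner G z (u + w) = inner G z u + inner G z w.
Proof.
rewrite -big_split; apply: eq_bigr => i _; rewrite -big_split/=.
by apply: eq_bigr => j _; rewrite mxE; ring.
Qed.

Lemma innerZr G (a : R) u z : inner G z (a *: u) = a * inner G z u.
Proof.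
rewrite mulr_sumr; apply: eq_bigr => i _; rewrite mulr_sumr/=.
by apply: eq_bigr => j _; rewrite mxE; ring.
Qed.

Lemma inner0r G z : inner G z 0 = 0.
Proof. by rewrite -(scale0r 0) innerZr mul0r. Qed.

Lemma innerNr G u z : inner G z (- u) = - inner G z u.
Proof. by rewrite -scaleN1r innerZr mulN1r. Qed.

Lemma inner_lower G u w : inner G u w = \sum_i lower G w 0 i * u 0 i.
Proof.
apply: eq_bigr => i _; rewrite mxE mulr_suml.
by apply: eq_bigr => j _; ring.
Qed.

Lemma lower_inner G w i : lower G w 0 i = inner G (e i) w.
Proof. by rewrite inner_lower sum_ebase. Qed.

Lemma inner_suml G u w : inner G u w = \sum_i inner G (e i) w * u 0 i.
Proof. by rewrite inner_lower; apply: eq_bigr => i _; rewrite lower_inner. Qed.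

Lemma inner_ebase G i j : inner G (e i) (e j) = G i j.
Proof. by rewrite -lower_inner mxE sum_ebase. Qed.

Lemma inner_ebaser G u j : inner G u (e j) = \sum_l u 0 l * G l j.
Proof.
by apply: eq_bigr => i _; rewrite sum_ebase mulrC.
Qed.

Lemma lowerE G w : lower G w = w *m G^T.
Proof. by apply/rowP => h; rewrite !mxE; apply: eq_bigr => k _; rewrite mxE mulrC. Qed.

Lemma lower_inj G : G \in unitmx -> injective (lower G).
Proof.
move=> uG u w; rewrite !lowerE => /(congr1 (mulmx^~ (invmx G^T))).
by rewrite !mulmxK ?unitmx_tr.
Qed.

Lemma invmx_lower G w k : G \in unitmx ->
  \sum_l invmx G k l * lower G w 0 l = w 0 k.
Proof.
move=> uG; have : (invmx G *m (lower G w)^T) k 0 = w 0 k.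
  by rewrite lowerE trmx_mul trmxK mulmxA mulVmx// mul1mx mxE.
by rewrite mxE => <-; apply: eq_bigr => l _; rewrite !mxE.
Qed.

Lemma lorentzian_unitmx G : lorentzian G -> G \in unitmx.
Proof.
move=> [_ [E uE EG]].
suff : E *m G *m E^T \in unitmx by rewrite !unitmx_mul => /andP[/andP[]].
rewrite EG unitmxE det_diag unitfE prodf_seq_neq0; apply/allP => i _ /=.
by rewrite mxE; case: ifP; rewrite ?oppr_eq0 oner_eq0.
Qed.

Lemma gamma_ebasel S i w : gamma S (e i) w = \sum_j w 0 j *: S i j.
Proof.
rewrite /gamma (bigD1 i)//= [X in _ + X]big1 ?addr0 => [|k /negPf ki].
  by apply: eq_bigr => j _; rewrite ebaseE eqxx mul1r.
by rewrite big1// => j _; rewrite ebaseE eq_sym ki mul0r scale0r.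
Qed.

Lemma gamma_ebase S i j : gamma S (e i) (e j) = S i j.
Proof.
rewrite gamma_ebasel (bigD1 j)//= ebaseE eqxx scale1r big1 ?addr0// => k /negPf kj.
by rewrite ebaseE eq_sym kj scale0r.
Qed.

Lemma gamma0l S w : gamma S 0 w = 0.
Proof. by rewrite /gamma big1// => i _; rewrite big1// => j _; rewrite mxE mul0r scale0r. Qed.

Lemma gammaDr S i u w : gamma S (e i) (u + w) = gamma S (e i) u + gamma S (e i) w.
Proof.
by rewrite !gamma_ebasel -big_split; apply: eq_bigr => j _; rewrite mxE scalerDl.
Qed.

Lemma gammaZr S i (a : R) w : gamma S (e i) (a *: w) = a *: gamma S (e i) w.
Proof.
by rewrite !gamma_ebasel scaler_sumr; apply: eq_bigr => j _; rewrite mxE scalerA.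
Qed.

(** D_U W = nabla_U W - pi(W) U + g(U, W) v, where [S] are the symbols of nabla. *)
Definition levi_civita_of G v S : 'I_n -> 'I_n -> V := fun i j =>
  S i j - inner G (e j) v *: e i + G i j *: v.

Lemma gamma_levi_civita_of G v S i w :
  gamma (levi_civita_of G v S) (e i) w =
  gamma S (e i) w - inner G w v *: e i + inner G (e i) w *: v.
Proof.
rewrite !gamma_ebasel -lower_inner [inner G w v]inner_lower mxE !scaler_suml.
rewrite -sumrB -big_split/=.
apply: eq_bigr => j _; rewrite /levi_civita_of lower_inner.
by rewrite !scalerDr scalerN !scalerA mulrC [G i j * _]mulrC.
Qed.

(** Everything takes place at one point: [G], [v], [S] are values there, and the
    derivatives of the corresponding fields are separate data, with the
    direction of differentiation as first index. [dp k h] is the derivative of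
    the covariant component v_h, [dS i j k] that of [S j k]. *)
Section SemiSymmetric.
Variables (G : 'M[R]_n) (v : V) (S : 'I_n -> 'I_n -> V).
Variable dG : 'I_n -> 'I_n -> 'I_n -> R.
Hypothesis GT : G^T = G.
Hypothesis metric_compatible : forall k i j,
  dG k i j = inner G (e j) (S k i) + inner G (e i) (S k j).
Hypothesis torsion_eq : forall i j,
  S i j - S j i = inner G (e j) v *: e i - inner G (e i) v *: e j.

Let Gsym i j : G i j = G j i. Proof. by rewrite -{1}GT mxE. Qed.

Let swap i j : S i j = S j i + (inner G (e j) v *: e i - inner G (e i) v *: e j).
Proof. by rewrite -torsion_eq; apply/esym; rewrite addrC subrK. Qed.

Let innerE := (innerDr, innerDl, innerNr, innerZr, innerZl, inner_ebase).

(** The uniqueness argument for the Levi-Civita connection: metricity turns each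
    derivative of the metric into two products with [S], and exchanging the
    arguments of [S] costs a torsion term; in the cyclic combination the products
    cancel except for twice the one with [S i j]. *)
Lemma koszul i j : G \in unitmx ->
  \row_k (2^-1 * \sum_l invmx G k l * (dG i j l + dG j i l - dG l i j)) =
  levi_civita_of G v S i j.
Proof.
move=> uG; apply/rowP => k; rewrite mxE -[RHS](invmx_lower _ _ uG) mulr_sumr.
apply: eq_bigr => l _; rewrite mulrCA; congr (_ * _).
rewrite lower_inner /levi_civita_of !metric_compatible.
rewrite (swap j i) (swap l i) (swap l j) !innerE.
by rewrite (Gsym j i) (Gsym l j) (Gsym l i); field.
Qed.

Variables (phi : R) (dv : 'I_n -> V) (dp : 'I_n -> 'I_n -> R).
Variable dS : 'I_n -> 'I_n -> 'I_n -> V.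
Hypothesis uG : G \in unitmx.
Hypothesis lower_leibniz : forall k h,
  dp k h = \sum_l (G h l * dv k 0 l + dG k h l * v 0 l).
Hypothesis torse_forming_form : forall k h,
  dp k h = inner G (S k h) v
           + phi * (inner G (e k) v * inner G (e h) v + G k h).
Hypothesis v_unit : inner G v v = - 1.
Hypothesis flat_symbols : forall i j k,
  dS i j k + gamma S (e i) (S j k) = dS j i k + gamma S (e j) (S i k).

(** A metric connection commutes with lowering indices, so the torse-forming
    equation for the covector field is the one for the vector field. *)
Lemma torse_forming_vector k :
  dv k + gamma S (e k) v = phi *: (inner G (e k) v *: v + e k).
Proof.
apply: (lower_inj uG); apply/rowP => h; rewrite !lower_inner !innerE.
have -> : phi * (inner G (e k) v * inner G (e h) v + G h k) =
    dp k h - inner G (S k h) v.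
  by rewrite torse_forming_form (Gsym h k) addrAC subrr add0r.
rewrite lower_leibniz big_split/= -[in LHS]lower_inner mxE -addrA; congr (_ + _).
rewrite gamma_ebasel.
have -> : inner G (e h) (\sum_j v 0 j *: S k j) =
    \sum_j inner G (e h) (S k j) * v 0 j.
  rewrite (big_morph _ (fun u w => innerDr G u w (e h)) (inner0r G (e h))).
  by apply: eq_bigr => j _; rewrite innerZr mulrC.
rewrite (innerC (S k h) v GT) (inner_suml _ v).
by rewrite -sumrB; apply: eq_bigr => j _; rewrite metric_compatible; ring.
Qed.

Let p i := inner G (e i) v.
Let D := levi_civita_of G v S.

(** What the Leibniz rule gives as derivative of [D j k] in the direction
    [e i]. *)
Definition dlevi_civita i j k : V :=
  dS i j k - dp i k *: e j + (dG i j k *: v + G j k *: dv i).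

(** The vector R(e_i, e_j) e_k. *)
Definition fluid_curvature i j k : V :=
  (1 + 2 * phi) *: (G j k *: e i - G i k *: e j)
  + phi *: (p k *: (p j *: e i - p i *: e j)
            + (G j k * p i - G i k * p j) *: v).

(** The products of basis vectors with [S] coming from the derivatives of the
    metric and from [gamma D] are together symmetric in [i] and [j] up to
    torsion; [dv i] meets [gamma S (e i) v], which completes it to the
    torse-forming expression; flatness removes the derivatives of [S]. *)
Lemma levi_civita_curvature i j k :
  dlevi_civita i j k + gamma D (e i) (D j k) - (dlevi_civita j i k + gamma D (e j) (D i k)) =
  fluid_curvature i j k.
Proof.
rewrite !gamma_levi_civita_of /dlevi_civita /D /levi_civita_of.
have -> : dS i j k = dS j i k + gamma S (e j) (S i k) - gamma S (e i) (S j k).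
  by rewrite -flat_symbols addrK.
rewrite !gammaDr -!scaleNr !gammaZr !gamma_ebase.
have dvE a : dv a = phi *: (inner G (e a) v *: v + e a) - gamma S (e a) v.
  by rewrite -torse_forming_vector addrK.
rewrite !dvE !torse_forming_form !metric_compatible (swap j i) !innerE.
rewrite v_unit /fluid_curvature -/(p i) -/(p j) -/(p k).
rewrite (Gsym j i) (Gsym k j) (Gsym k i).
by apply/rowP => m; rewrite !mxE; ring.
Qed.

Lemma fluid_curvature_trace h k :
  \sum_i fluid_curvature i h k 0 i =
  (n%:R - 1 + (2 * n%:R - 3) * phi) * G h k + (n%:R - 2) * phi * p h * p k.
Proof.
have tr1 : \sum_i e i 0 i = n%:R :> R.
  rewrite (eq_bigr (fun=> 1)) ?sumr_const ?card_ord// => i _.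
  by rewrite ebaseE eqxx.
have trp : \sum_i p i * v 0 i = - 1 by rewrite -v_unit inner_suml.
have trG : \sum_i G i k * v 0 i = p k.
  by rewrite /p -lower_inner mxE; apply: eq_bigr => i _; rewrite Gsym.
rewrite (eq_bigr (fun i => (1 + 2 * phi) * (G h k * e i 0 i - G i k * e h 0 i)
   + phi * (p k * (p h * e i 0 i - p i * e h 0 i)
            + (G h k * (p i * v 0 i) - p h * (G i k * v 0 i))))); last first.
  by move=> i _; rewrite !mxE; ring.
rewrite big_split/= -!mulr_sumr sumrB big_split/= sumrB -!mulr_sumr sumrB -!mulr_sumr.
rewrite tr1 trp trG !sum_ebase; ring.
Qed.

(** Independence of the two tensors. Contracting with [v] in one index gives
    a = b, since v is unit time-like; the trace with the inverse metric is then
    a n - b = a (n - 1). *)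
Lemma fluid_eq0 a b : (1 < n)%N ->
  (forall h k, a * G h k + b * p h * p k = 0) -> a = 0 /\ b = 0.
Proof.
move=> n1 ab0.
have trp : \sum_i p i * v 0 i = - 1 by rewrite -v_unit inner_suml.
have abp h : (a - b) * p h = 0.
  transitivity (\sum_k (a * G h k + b * p h * p k) * v 0 k).
    rewrite (eq_bigr (fun k => a * (G h k * v 0 k) + b * p h * (p k * v 0 k))).
      rewrite big_split -!mulr_sumr/= trp.
      have -> : \sum_k G h k * v 0 k = p h by rewrite /p -lower_inner mxE.
      by ring.
    by move=> k _; ring.
  by rewrite big1// => k _; rewrite ab0 mul0r.
have ab : a = b.
  apply/eqP; rewrite -subr_eq0 -oppr_eq0 -mulrN1 -trp mulr_sumr big1// => i _.
  by rewrite mulrA abp mul0r.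
have : a * (n%:R - 1) = 0.
  transitivity (\sum_h \sum_k invmx G h k * (a * G k h + b * p k * p h)).
    transitivity (\sum_h (a * (invmx G *m G) h h + b * (p h * v 0 h))).
      rewrite big_split -!mulr_sumr/= trp mulVmx// -ab.
      by rewrite -/(\tr (1%:M : 'M[R]_n)) mxtrace1; ring.
    apply: eq_bigr => h _; rewrite -(invmx_lower v h uG) mxE !mulr_sumr -big_split/=.
    by apply: eq_bigr => k _; rewrite lower_inner -/(p k); ring.
  by rewrite big1// => h _; rewrite big1// => k _; rewrite ab0 mulr0.
move/eqP; rewrite mulf_eq0 subr_eq0 (eqr_nat _ n 1) (gtn_eqF n1) orbF => /eqP a0.
by rewrite -ab a0.
Qed.

End SemiSymmetric.
End PointwiseAlgebra.

(** * Derivatives in a chart *)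

Section ChartCalculus.
Variables (R : realType) (n : nat).
Local Notation V := 'rV[R]_n.
Local Notation e := (ebase R (n:=n)).
Implicit Types (Gam : symbols R n) (x : V).

Lemma derivable_row (X : V -> V) x w :
  (forall i, derivable (fun y => X y 0 i) x w) -> derivable X x w.
Proof. by move=> dX; apply/derivable_mxP => i j; rewrite ord1. Qed.

Lemma derive_coord (X : V -> V) x w i :
  (forall i, derivable (fun y => X y 0 i) x w) ->
  ('D_w X x) 0 i = 'D_w (fun y => X y 0 i) x.
Proof. by move=> dX; rewrite derive_mx ?mxE//; exact: derivable_row. Qed.

Lemma derive_row (X : V -> V) x w (dX : V) :
  (forall i, is_derive x w (fun y => X y 0 i) (dX 0 i)) -> 'D_w X x = dX.
Proof.
move=> dXi; apply/rowP => i.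
by rewrite derive_coord ?derive_val// => j; exact: ex_derive.
Qed.

Lemma cov_cst Gam (u w : V) x : cov Gam (fun=> u) (fun=> w) x = gamma (Gam x) u w.
Proof. by rewrite /cov derive_cst add0r. Qed.

Lemma lie_bracket_cst (u w : V) x : lie_bracket (fun=> u) (fun=> w) x = 0.
Proof. by rewrite /lie_bracket !derive_cst subr0. Qed.

Lemma torsion_ebase Gam i j x :
  torsion Gam (fun=> e i) (fun=> e j) x = Gam x i j - Gam x j i.
Proof. by rewrite /torsion !cov_cst lie_bracket_cst subr0 !gamma_ebase. Qed.

Lemma curvature_ebase Gam i j k x :
  curvature Gam (fun=> e i) (fun=> e j) (fun=> e k) x =
  'D_(e i) (fun y => Gam y j k) x + gamma (Gam x) (e i) (Gam x j k)
  - ('D_(e j) (fun y => Gam y i k) x + gamma (Gam x) (e j) (Gam x i k)).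
Proof.
have cov_e a b : cov Gam (fun=> e a) (fun=> e b) = fun y => Gam y a b.
  by apply/funext => y; rewrite cov_cst gamma_ebase.
have lie0 : lie_bracket (fun=> e i) (fun=> e j) = fun=> (0 : V).
  by apply/funext => y; exact: lie_bracket_cst.
rewrite /curvature !cov_e lie0 cov_cst gamma0l subr0.
by rewrite /cov.
Qed.

End ChartCalculus.

(** * Flat semi-symmetric metric connections with torse-forming vector field *)

Section FlatTorseForming.
Variables (R : realType) (n : nat) (M : manifold R n).
Variables (g : lorentz_metric M) (nabla : linear_connection M) (v : vector_field M).
Local Notation V := 'rV[R]_n.
Local Notation e := (ebase R (n:=n)).
Local Notation U c := (@chart_image R n M c).
Local Notation p c y i := (inner (g c y) (e i) (v c y)).

Hypothesis ssm : semi_symmetric_metric_connection g nabla v.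
Hypothesis nabla_flat : flat nabla.
Hypothesis v_unit : unit_timelike g v.
Variable phi : M -> R.
Hypothesis v_torse : forall c x, U c x ->
  forall k h, cov_form (nabla c) (fun y => lower (g c y) (v c y)) x k h =
    phi (chart_inv c x) * (lower (g c x) (v c x) 0 k * lower (g c x) (v c x) 0 h
                           + g c x k h).

Lemma open_chart_image c : open (U c).
Proof. exact: image_is_open. Qed.

Section AtPoint.
Variables (c : chart M) (x : V).
Hypothesis Ux : U c x.

Lemma metric_sym : (g c x)^T = g c x.
Proof. by have [] := met_lorentzian g Ux. Qed.

Lemma metric_unit : g c x \in unitmx.
Proof. exact/lorentzian_unitmx/met_lorentzian. Qed.

Lemma derive_metric k i j :
  'D_(e k) (fun y => g c y i j) x =
  inner (g c x) (e j) (nabla c x k i) + inner (g c x) (e i) (nabla c x k j).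
Proof.
have /eqP := ssm.1 c x Ux k i j; rewrite /cov_metric -addrA -opprD subr_eq0 => /eqP ->.
rewrite -inner_ebaser innerC ?metric_sym//; congr (_ + _).
by rewrite -lower_inner mxE; apply: eq_bigr => l _; rewrite mulrC.
Qed.

Lemma nabla_torsion i j :
  nabla c x i j - nabla c x j i = p c x j *: e i - p c x i *: e j.
Proof.
rewrite -torsion_ebase ssm.2//; exact: smooth_field_cst.
Qed.

Lemma nabla_curvature i j k :
  'D_(e i) (fun y => nabla c y j k) x + gamma (nabla c x) (e i) (nabla c x j k)
  = 'D_(e j) (fun y => nabla c y i k) x + gamma (nabla c x) (e j) (nabla c x i k).
Proof.
apply/eqP; rewrite -subr_eq0 -curvature_ebase nabla_flat//; exact: smooth_field_cst.
Qed.

Let is_derive_v k i :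
  is_derive x (e k) (fun y => v c y 0 i) ('D_(e k) (fun y => v c y 0 i) x).
Proof. apply: derivableP; exact: smooth_on_derivable (vf_smooth v c i) Ux. Qed.

Let is_derive_g k i j :
  is_derive x (e k) (fun y => g c y i j) ('D_(e k) (fun y => g c y i j) x).
Proof. apply: derivableP; exact: smooth_on_derivable (met_smooth g c i j) Ux. Qed.

Let is_derive_nabla k i j l :
  is_derive x (e k) (fun y => nabla c y i j 0 l)
            ('D_(e k) (fun y => nabla c y i j 0 l) x).
Proof. apply: derivableP; exact: smooth_on_derivable (conn_smooth nabla c i j l) Ux. Qed.

Let dv k := 'D_(e k) (v c) x.
Let dp k h := 'D_(e k) (fun y => p c y h) x.

Lemma dvE k i : dv k 0 i = 'D_(e k) (fun y => v c y 0 i) x.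
Proof.
by rewrite /dv derive_coord// => j; exact: ex_derive.
Qed.

Lemma is_derive_p k h : is_derive x (e k) (fun y => p c y h)
  (\sum_l (g c x h l * dv k 0 l + 'D_(e k) (fun y => g c y h l) x * v c x 0 l)).
Proof.
rewrite (_ : (fun y => _) = fun y => \sum_l g c y h l * v c y 0 l); last first.
  by apply/funext => y; rewrite -lower_inner mxE.
apply: is_derive_bigsum => l; rewrite dvE.
by rewrite [X in _ + X]mulrC; exact: is_deriveM.
Qed.

Lemma derive_p_leibniz k h : dp k h =
  \sum_l (g c x h l * dv k 0 l + 'D_(e k) (fun y => g c y h l) x * v c x 0 l).
Proof. by have dp_kh := is_derive_p k h; exact: derive_val. Qed.

Lemma derive_p k h : dp k h = inner (g c x) (nabla c x k h) (v c x) +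
  phi (chart_inv c x) * (p c x k * p c x h + g c x k h).
Proof.
have := v_torse Ux k h; rewrite /cov_form !lower_inner => <-.
rewrite inner_lower.
have -> : (fun y => lower (g c y) (v c y) 0 h) = fun y => p c y h.
  by apply/funext => y; rewrite lower_inner.
under [X in _ = X + _]eq_bigr do rewrite mulrC.
by rewrite addrC subrK.
Qed.

Lemma derive_levi_civita_of i j k :
  'D_(e i) (fun y => levi_civita_of (g c y) (v c y) (nabla c y) j k) x =
  dlevi_civita (g c x) (v c x) (fun k i j => 'D_(e k) (fun y => g c y i j) x) dv dp
     (fun i j k => 'D_(e i) (fun y => nabla c y j k) x) i j k.
Proof.
apply: derive_row => m; rewrite /levi_civita_of /dlevi_civita.
rewrite (_ : (fun y => _) = (fun y => nabla c y j k 0 m)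
  - e j 0 m \*: (fun y => p c y k)
  + (fun y => g c y j k) * (fun y => v c y 0 m)); last first.
  by apply/funext => y; rewrite !fctE !mxE/= [_ *: _]mulrC.
have dpk : is_derive x (e i) (fun y => p c y k) (dp i k).
  by apply: derivableP; have dp_ik := is_derive_p i k; exact: ex_derive.
apply: (is_derive_eq (is_deriveD
  (is_deriveB (is_derive_nabla i j k m) (is_deriveZ (e j 0 m) dpk))
  (is_deriveM (is_derive_g i j k) (is_derive_v i m)))).
have coordE (A B C E : V) (a b d : R) :
    (A - a *: B + (b *: C + d *: E)) 0 m =
    A 0 m - a * B 0 m + (b * C 0 m + d * E 0 m) by rewrite !mxE.
rewrite coordE dvE derive_coord => [|l]; last exact: ex_derive.
rewrite [dp i k * _]mulrC [X in _ = _ + X]addrC; congr (_ + (_ + _)).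
exact: mulrC.
Qed.

End AtPoint.

Lemma christoffelE c x i j : U c x ->
  christoffel (g c) x i j = levi_civita_of (g c x) (v c x) (nabla c x) i j.
Proof.
move=> Ux; rewrite /christoffel.
exact: (koszul (metric_sym Ux) (derive_metric Ux) (nabla_torsion Ux) _ _ (metric_unit Ux)).
Qed.

Lemma ricciE c x h k : U c x -> ricci (christoffel (g c)) x h k =
  (n%:R - 1 + (2 * n%:R - 3) * phi (chart_inv c x)) * g c x h k
  + (n%:R - 2) * phi (chart_inv c x) * p c x h * p c x k.
Proof.
move=> Ux; rewrite -(fluid_curvature_trace (metric_sym Ux) _ (v_unit Ux)).
apply: eq_bigr => i _; congr (fun_of_matrix _ 0 i).
(* Differentiating the symbols of D uses their expression near [x], not only
   at [x]. *)
have dchr a b d : 'D_(e a) (fun y => christoffel (g c) y b d) x =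
    'D_(e a) (fun y => levi_civita_of (g c y) (v c y) (nabla c y) b d) x.
  apply: near_eq_derive; apply: near_open (@open_chart_image c) Ux _ => y Uy.
  exact: christoffelE.
have chr : christoffel (g c) x = levi_civita_of (g c x) (v c x) (nabla c x).
  by apply/funext => a; apply/funext => b; exact: christoffelE.
rewrite curvature_ebase !dchr chr !derive_levi_civita_of//.
exact: (levi_civita_curvature (metric_sym Ux) (derive_metric Ux)
  (nabla_torsion Ux) (metric_unit Ux) (derive_p_leibniz Ux) (derive_p Ux)
  (v_unit Ux) (nabla_curvature Ux)).
Qed.

(** The left-hand side is the divergence of [v] with respect to [nabla]. It only
    involves [v] and the symbols, which are smooth, so it controls the regularity
    of [phi]. *)
Lemma div_v c x : U c x ->
  \sum_k ('D_(e k) (fun y => v c y 0 k) x + \sum_j v c x 0 j * nabla c x k j 0 k)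
  = (n%:R - 1) * phi (chart_inv c x).
Proof.
move=> Ux.
transitivity (\sum_k ('D_(e k) (v c) x + gamma (nabla c x) (e k) (v c x)) 0 k).
  apply: eq_bigr => k _; rewrite mxE dvE// gamma_ebasel summxE; congr (_ + _).
  by apply: eq_bigr => j _; rewrite mxE.
under eq_bigr => k _.
  rewrite (torse_forming_vector (metric_sym Ux) (derive_metric Ux) (metric_unit Ux)
    (derive_p_leibniz Ux) (derive_p Ux)) !mxE !eqxx.
  over.
rewrite -mulr_sumr big_split/= sumr_const card_ord mulrC; congr (_ * _).
by rewrite -inner_suml (v_unit Ux) addrC.
Qed.

Lemma smooth_phi c : (1 < n)%N -> smooth_on (U c) (phi \o chart_inv c).
Proof.
move=> n1 k; have oU := @open_chart_image c.
have n10 : n%:R - 1 != 0 :> R by rewrite subr_eq0 (eqr_nat _ n 1) gtn_eqF.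
apply: (@Ck_on_eq _ _ _ _ (fun x => (n%:R - 1)^-1 * \sum_k
  ('D_(e k) (fun y => v c y 0 k) x + \sum_j v c x 0 j * nabla c x k j 0 k))) => //.
  by move=> x Ux; rewrite div_v// mulKf.
apply: Ck_onM => //; first exact: Ck_on_cst.
apply: smooth_on_sum => // {}k l; apply: Ck_onD => //.
  by apply: smooth_on_derive; exact: vf_smooth.
apply: smooth_on_sum => // j {}l; apply: Ck_onM => //.
  exact: vf_smooth.
exact: conn_smooth.
Qed.

End FlatTorseForming.

Theorem theorem1p3 (R : realType) (n : nat) (hn : (3 <= n)%N) (S : spacetime R n)
    (nabla : linear_connection S) (v : vector_field S)
    (hnabla : semi_symmetric_metric_connection (spacetime_metric S) nabla v)
    (hflat : flat nabla)
    (hunit : unit_timelike (spacetime_metric S) v)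
    (htorse : unit_torse_forming (spacetime_metric S) nabla v) :
  perfect_fluid S.
Proof.
have n1 : (1 < n)%N := ltnW hn.
have [phi v_torse] := htorse.
have ric c x := ricciE hnabla hflat hunit v_torse (c := c) (x := x).
have affine_smooth (a b : R) : smooth_function (fun q : S => a + b * phi q).
  move=> c k; have oU := @open_chart_image _ _ _ c.
  apply: Ck_onD => //; first exact: Ck_on_cst.
  apply: Ck_onM => //; first exact: Ck_on_cst.
  exact: (smooth_phi hnabla hunit v_torse).
split=> [c x Ux|].
  apply: contrapT => no_ricci.
  have [|a0 /eqP] := fluid_eq0 (metric_unit (spacetime_metric S) Ux) (hunit c x Ux) n1
     (a := n%:R - 1 + (2 * n%:R - 3) * phi (chart_inv c x))
     (b := (n%:R - 2) * phi (chart_inv c x)).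
    move=> h k; rewrite -ric//; apply/eqP/negP => /negP ric0.
    by apply: no_ricci; exists h, k.
  rewrite mulf_eq0 subr_eq0 (eqr_nat _ n 2) (gtn_eqF hn)/= => /eqP phi0.
  move/eqP: a0; rewrite phi0 mulr0 addr0 subr_eq0 (eqr_nat _ n 1).
  by rewrite (gtn_eqF n1).
exists (fun q => (n%:R - 1) + (2 * n%:R - 3) * phi q).
(* The summand 0 makes this an instance of [affine_smooth]. *)
exists (fun q => 0 + (n%:R - 2) * phi q).
exists v; split=> // c x Ux /= h k.
by rewrite /ricci_tensor ric// add0r !lower_inner.
Qed.
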